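(* The category $\mathfrak{P}^+$ of finite posets and monotone maps is coregular, i.e., its opposite category is regular. The regular monomorphisms in $\mathfrak{P}^+$ are exactly the embeddings of posets.
   Context: A function $\alpha\colon P\to Q$ of posets is monotone if $x\le y$ implies $\alpha(x)\le\alpha(y)$; it is an embedding if it is injective and $x\le y\iff\alpha(x)\le\alpha(y)$. A morphism is a regular epimorphism if it is the co-equalizer of some pair of parallel morphisms. A category is regular if it has finite limits, the kernel pair $Y\times_XY\rightrightarrows Y$ of any morphism $Y\to X$ admits a co-equalizer, and any base change of a regular epimorphism is a regular epimorphism. A regular monomorphism is a morphism that is a regular epimorphism in the opposite category, i.e., the equalizer of some pair of parallel morphisms. The empty poset is an object of $\mathfrak{P}^+$. *)

(* Defs.v *)
From HB Require Import structures.
From mathcomp Require Import all_boot all_order.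
From Stdlib Require Import FunctionalExtensionality.

Set Implicit Arguments.
Unset Strict Implicit.
Unset Printing Implicit Defensive.

Import Order.Theory.

Local Open Scope order_scope.

(** * Categories, limits and regularity *)

Record category := Category {
  obj :> Type;
  hom : obj -> obj -> Type;
  idm : forall a, hom a a;
  cmp : forall a b c, hom b c -> hom a b -> hom a c;
  cmp1m : forall a b (f : hom a b), cmp (idm b) f = f;
  cmpm1 : forall a b (f : hom a b), cmp f (idm a) = f;
  cmpA : forall a b c e (h : hom c e) (g : hom b c) (f : hom a b),
    cmp h (cmp g f) = cmp (cmp h g) f }.

Arguments hom {c} a b : rename.
Arguments idm {c} a : rename.
Arguments cmp {c a b c0} g f : rename.

Definition opposite (C : category) : category :=
  @Category C (fun a b => @hom C b a) (fun a => idm a)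
    (fun a b c g f => cmp f g)
    (fun a b f => cmpm1 f) (fun a b f => cmp1m f)
    (fun a b c e h g f => esym (cmpA f g h)).

Record functor (J C : category) := Functor {
  fobj :> J -> C;
  fmap : forall i j, @hom J i j -> @hom C (fobj i) (fobj j);
  fmap1 : forall i, fmap (idm i) = idm (fobj i);
  fmapM : forall i j k (v : @hom J j k) (u : @hom J i j),
    fmap (cmp v u) = cmp (fmap v) (fmap u) }.

Definition finite_type (T : Type) : Prop :=
  exists (n : nat) (f : 'I_n -> T), bijective f.

Definition finite_category (J : category) : Prop :=
  finite_type J /\ forall i j : J, finite_type (hom i j).

Definition is_cone (J C : category) (F : functor J C) (L : C)
    (p : forall j : J, hom L (F j)) : Prop :=
  forall (i j : J) (u : hom i j), cmp (fmap F u) (p i) = p j.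

Definition is_limit (J C : category) (F : functor J C) (L : C)
    (p : forall j : J, hom L (F j)) : Prop :=
  is_cone p /\
  forall (M : C) (q : forall j : J, hom M (F j)), is_cone q ->
    exists! t : hom M L, forall j : J, cmp (p j) t = q j.

Definition has_finite_limits (C : category) : Prop :=
  forall (J : category) (F : functor J C), finite_category J ->
    exists (L : C) (p : forall j : J, hom L (F j)), is_limit p.

(* [q] is a co-equalizer of the parallel pair [u], [v]. *)
Definition is_coequalizer (C : category) (A B Q : C) (u v : hom A B)
    (q : hom B Q) : Prop :=
  cmp q u = cmp q v /\
  forall (Z : C) (h : hom B Z), cmp h u = cmp h v ->
    exists! t : hom Q Z, cmp t q = h.

(*      p2
     P ----> Y
  p1 |       | f
     v       v
     X' ---> X
         g         *)
Definition is_pullback (C : category) (X' Y X P : C) (g : hom X' X)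
    (f : hom Y X) (p1 : hom P X') (p2 : hom P Y) : Prop :=
  cmp g p1 = cmp f p2 /\
  forall (Z : C) (z1 : hom Z X') (z2 : hom Z Y), cmp g z1 = cmp f z2 ->
    exists! t : hom Z P, cmp p1 t = z1 /\ cmp p2 t = z2.

Definition is_kernel_pair (C : category) (Y X P : C) (f : hom Y X)
    (p1 p2 : hom P Y) : Prop :=
  is_pullback f f p1 p2.

Definition regular_epi (C : category) (B Q : C) (q : hom B Q) : Prop :=
  exists (A : C) (u v : hom A B), is_coequalizer u v q.

Definition regular_mono (C : category) (A B : C) (f : @hom C A B) : Prop :=
  @regular_epi (opposite C) B A f.

Definition regular_category (C : category) : Prop :=
  [/\ has_finite_limits C,
      forall (Y X P : C) (f : hom Y X) (p1 p2 : hom P Y),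
        is_kernel_pair f p1 p2 ->
        exists (Q : C) (q : hom Y Q), is_coequalizer p1 p2 q
    & forall (X' Y X P : C) (g : hom X' X) (f : hom Y X)
        (p1 : hom P X') (p2 : hom P Y),
        is_pullback g f p1 p2 -> regular_epi f -> regular_epi p1].

Definition coregular_category (C : category) : Prop :=
  regular_category (opposite C).

(** * Finite posets *)

Definition embedding d d' (P : finPOrderType d) (Q : finPOrderType d')
    (f : P -> Q) : Prop :=
  injective f /\ {mono f : x y / x <= y}.

Lemma omorphism_ext d d' (P : porderType d) (Q : porderType d')
    (f g : {omorphism P -> Q}) : f =1 g -> f = g.
Proof.
case: f g => f [[Hf]] [g [[Hg]]] /= /functional_extensionality efg.
subst g; suff -> : Hf = Hg by [].
do 3![apply: functional_extensionality_dep => ?]; exact: eq_irrelevance.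
Qed.

(* The display [d] is only a tag that selects notations: it carries no
   mathematical content, and every finite poset can be given any display. *)
Definition finPoset (d : Order.disp_t) : category :=
  @Category (finPOrderType d) (fun P Q => {omorphism P -> Q})
    (fun P => idfun : {omorphism P -> P})
    (fun P Q R g f => (g \o f) : {omorphism P -> R})
    (fun P Q f => @omorphism_ext d d P Q (idfun \o f) f (frefl f))
    (fun P Q f => @omorphism_ext d d P Q (f \o idfun) f (frefl f))
    (fun P Q R S h g f => @omorphism_ext d d P S (h \o (g \o f))
       ((h \o g) \o f) (frefl (h \o (g \o f)))).

(* Main.v *)
Require Import Defs.
From HB Require Import structures.
From mathcomp Require Import all_boot all_order.
From mathcomp Require Import boolp.

Set Implicit Arguments.
Unset Strict Implicit.
Unset Printing Implicit Defensive.

Import Order.Theory.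

Local Open Scope order_scope.

(** Power sets ordered by inclusion carry the whole argument.

    Every finite preorder maps to a power set by sending x to the set of
    elements below x, and the image of this map is the poset reflection of the
    preorder.  A finite diagram of posets therefore has a colimit: on the
    disjoint union of its posets, let the orders and the identifications
    x ~ F(u)(x), each read as two inequalities, generate a preorder, and take
    its reflection ([presented_poset_universal], [finite_colimit]).  In the
    opposite category these are the finite limits.

    The equalizer of two monotone maps is the induced poset on the points where
    they agree ([equalizer_mapP]).  Comparing it with an arbitrary equalizer
    shows that every regular monomorphism is an embedding.  Conversely an
    embedding f : P -> Q is the equalizer of the two maps from Q to its power
    set that send x to the elements outside f(P) which are below x,
    respectively strictly below x: they differ at x exactly when x itself is
    outside f(P).

    It remains to see that embeddings are stable under pushout.  Power sets are
    injective for embeddings: for an embedding f : X -> Y and g : X -> X', the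
    map X -> 2^X' sending x to the lower set of g(x) extends along f to Y.  With
    the embedding X' -> 2^X' by lower sets this is a cocone, so X' -> 2^X'
    factors through the pushout X' -> P, which must then reflect the order
    ([pushout_embedding]). *)

(** * Power sets and induced posets *)

Definition monotone_map d d' (P : finPOrderType d) (Q : finPOrderType d')
    (f : P -> Q) (mon_f : {homo f : x y / x <= y}) : {omorphism P -> Q} :=
  HB.pack_for {omorphism P -> Q} f (Order.isOrderMorphism.Build d P d' Q f mon_f).

Lemma omorphism_app d d' (P : finPOrderType d) (Q : finPOrderType d')
  (f g : {omorphism P -> Q}) (x : P) : f = g -> f x = g x.
Proof. by move->. Qed.

Lemma subset_anti (T : finType) : antisymmetric (fun A B : {set T} => A \subset B).
Proof. by move=> A B ABA; apply/eqP; rewrite eqEsubset. Qed.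

Definition powerset_poset (d : Order.disp_t) (T : finType) : finPOrderType d :=
  HB.pack_for (finPOrderType d) {set T}
    (Order.Le_isPOrder.Build d {set T} (@subxx _ _) (@subset_anti T)
       (fun A B => @subset_trans _ B A)).

Definition subposet d (P : finPOrderType d) (A : pred P) : finPOrderType d :=
  HB.pack_for (finPOrderType d) {x : P | A x}
    (Finite.on {x : P | A x})
    [SubChoice_isSubPOrder of {x : P | A x} by <: with d].

(** Antisymmetry makes an order-reflecting map injective. *)
Lemma mono_embedding d d' (P : finPOrderType d) (Q : finPOrderType d')
  (f : P -> Q) : {mono f : x y / x <= y} -> embedding f.
Proof. by move=> mono_f; split=> //; apply: inc_inj. Qed.

Definition lower_set d (P : finPOrderType d) (x : P) : {set P} :=
  [set y | y <= x].

Lemma sub_lower_set d (P : finPOrderType d) (x y : P) :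
  (lower_set x \subset lower_set y) = (x <= y).
Proof.
apply/subsetP/idP => [/(_ x)|le_xy z]; rewrite !inE ?lexx; first exact.
by move=> /le_trans; apply.
Qed.

(** * Posets presented by generators and inequalities *)

Section PresentedPoset.
Variables (d : Order.disp_t) (T : finType) (r : rel T).

Definition ancestors (x : T) : {set T} := [set y | connect r y x].

(** The poset reflection of the preorder generated by [r].  Two generators are
    equivalent for this preorder exactly when they have the same ancestors, so
    the sets of ancestors stand for the equivalence classes. *)
Definition presented_poset : finPOrderType d :=
  subposet (P := powerset_poset d T) (fun A => A \in codom ancestors).

Definition generator (x : T) : presented_poset :=
  Sub (ancestors x) (codom_f ancestors x).

Lemma le_generator x y : (generator x <= generator y) = connect r x y.
Proof.
apply/subsetP/idP => [/(_ x)|le_xy z]; rewrite !inE ?connect0; first exact.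
by move=> /connect_trans; apply.
Qed.

Lemma generator_eq x y :
  connect r x y -> connect r y x -> generator x = generator y.
Proof. by move=> le_xy le_yx; apply: le_anti; rewrite !le_generator le_xy. Qed.

(** A map that respects the relations respects the preorder they generate, by
    induction along paths; hence it does not depend on the representative of
    a class. *)
Lemma presented_poset_universal (Z : finPOrderType d) (h : T -> Z) :
  (forall x y, r x y -> h x <= h y) ->
  exists! t : {omorphism presented_poset -> Z}, forall x, t (generator x) = h x.
Proof.
move=> mon_h.
have mon_connect x y : connect r x y -> h x <= h y.
  case/connectP=> p + ->; elim: p x => //= z p IHp x /andP[/mon_h le_xz /IHp].
  exact: le_trans.
pose rep (A : presented_poset) := iinv (valP A).
have repK A : generator (rep A) = A by apply: val_inj; apply: f_iinv.
have mon_t : {homo h \o rep : A B / A <= B}.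
  move=> A B; rewrite -[A in A <= _]repK -[B in _ <= B]repK le_generator.
  exact: mon_connect.
exists (monotone_map mon_t); split=> [x|t tE].
  by apply: le_anti; apply/andP; split; apply: mon_connect;
     rewrite -le_generator repK.
by apply: omorphism_ext => A /=; rewrite -tE repK.
Qed.

End PresentedPoset.

(** * Finite colimits *)

Section FiniteColimits.
Variables (d : Order.disp_t) (J : category).
Variable F : functor J (opposite (finPoset d)).

(** Arrows of [J] act backwards, since [F] takes values in the opposite
   category. *)
Definition diagram_poset (j : J) : finPOrderType d := F j.

Definition diagram_map i j (u : hom i j) :
  {omorphism diagram_poset j -> diagram_poset i} := fmap F u.

Definition at_index (j : J) (x : diagram_poset j) : {j : J & diagram_poset j} :=
  existT (fun j => diagram_poset j) j x.

(** The inequalities that present the colimit.  The last two constructors force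
    x and its image under an arrow to be equal in the quotient. *)
Inductive glue : {j : J & diagram_poset j} -> {j : J & diagram_poset j} -> Prop :=
| glue_le (j : J) (x y : diagram_poset j) of x <= y : glue (at_index x) (at_index y)
| glue_fmap i j (u : hom i j) x :
    glue (at_index x) (at_index (diagram_map u x))
| glue_fmap_sym i j (u : hom i j) x :
    glue (at_index (diagram_map u x)) (at_index x).

(** The colimit is presented by the disjoint union of the posets of the diagram
    and the relation [glue]. *)
Lemma finite_colimit : finite_type J ->
  exists (L : opposite (finPoset d)) (p : forall j : J, hom L (F j)), is_limit p.
Proof.
case=> n [f [g _ gK]].
(* Posets are indexed here by ordinals and not by [J]: the objects of [J] may
   live in a universe that is too large for the carrier of a finite type.
   [realize] and [code] translate between both indexings. *)
pose T := {i : 'I_n & diagram_poset (f i)}.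
pose realize (s : T) := at_index (tagged s).
have realize_surj z : exists s, `[< realize s = z >].
  case: z => j; rewrite -(gK j) => x.
  by exists (existT (fun i => diagram_poset (f i)) (g j) x); apply/asboolP.
pose code z := xchoose (realize_surj z).
have codeK z : realize (code z) = z by apply/asboolP/(xchooseP (realize_surj z)).
pose r (s t : T) := `[< glue (realize s) (realize t) >].
have r_code a b : glue a b -> connect r (code a) (code b).
  by move=> glue_ab; apply/connect1/asboolP; rewrite !codeK.
pose L : finPOrderType d := presented_poset d r.
have inj_mono j :
    {homo (fun x : diagram_poset j => generator d r (code (at_index x))) :
       x y / x <= y}.
  by move=> x y le_xy; rewrite le_generator; apply/r_code/glue_le.
pose p j : {omorphism diagram_poset j -> L} := monotone_map (@inj_mono j).
exists L, p; split=> [i j u|M q q_cone].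
  apply: omorphism_ext => x /=; apply: generator_eq.
    exact/r_code/glue_fmap_sym.
  exact/r_code/glue_fmap.
pose qf j : {omorphism diagram_poset j -> M} := q j.
have qE i j (u : hom i j) x : qf i (diagram_map u x) = qf j x.
  by rewrite /qf -(q_cone i j u).
pose h (z : {j : J & diagram_poset j}) := qf (tag z) (tagged z).
have h_glue a b : glue a b -> h a <= h b.
  by case=> [j x y le_xy|i j u x|i j u x]; rewrite /h /= ?qE //; apply: omorph_le.
have [|t [tE t_uniq]] := @presented_poset_universal d T r M (h \o realize).
  by move=> x y /asboolP; apply: h_glue.
exists t; split=> [j|t' t'E].
  by apply: omorphism_ext => x; rewrite /= tE /= codeK.
apply: t_uniq => s /=.
have glue_refl : glue (realize s) (realize s) by apply: glue_le.
have -> : generator d r s = generator d r (code (realize s)).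
  by apply: generator_eq; apply/connect1/asboolP; rewrite codeK.
by rewrite /h /qf -t'E; case: (realize s).
Qed.

End FiniteColimits.

(** * Equalizers and regular monomorphisms *)

Section Equalizer.
Variables (d : Order.disp_t) (P Q : finPOrderType d).

Definition equalizer_poset (u v : P -> Q) : finPOrderType d :=
  subposet (fun x => u x == v x).

Definition equalizer_map (u v : P -> Q) : {omorphism equalizer_poset u v -> P} :=
  @monotone_map d d (equalizer_poset u v) P val (fun _ _ => id).

(** Equalizers in a category are the coequalizers of its opposite. *)
Lemma equalizer_mapP (u v : {omorphism P -> Q}) :
  @is_coequalizer (opposite (finPoset d)) Q P (equalizer_poset u v) u v
    (equalizer_map u v).
Proof.
split=> [|Z h h_eq].
  by apply: omorphism_ext => x; apply/eqP/(valP x).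
have huv z : u (h z) == v (h z).
  by apply/eqP; apply: (omorphism_app z h_eq).
pose t z : equalizer_poset u v := Sub (h z) (huv z).
have mon_t : {homo t : x y / x <= y} by move=> x y; apply: omorph_le.
exists (monotone_map mon_t); split=> [|t' t'E]; first exact: omorphism_ext.
by apply: omorphism_ext => z; apply/val_inj/esym/(omorphism_app z t'E).
Qed.

End Equalizer.

Section RegularMono.
Variables (d : Order.disp_t) (P Q : finPOrderType d) (f : {omorphism P -> Q}).

(** An equalizer f of u and v is isomorphic over Q to the induced poset on the
    points where u and v agree, and the inclusion of the latter reflects the
    order. *)
Lemma regular_mono_embedding : @regular_mono (finPoset d) P Q f -> embedding f.
Proof.
case=> A [u [v [uf_vf f_univ]]]; apply: mono_embedding => x y.
apply/idP/idP => [|]; last exact: omorph_le.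
have [uE _] := equalizer_mapP u v.
have [t [tE _]] := f_univ _ _ uE.
have fE (z : P) : u (f z) == v (f z).
  by apply/eqP; apply: (omorphism_app z uf_vf).
pose s z : equalizer_poset u v := Sub (f z) (fE z).
have mon_s : {homo s : x y / x <= y} by move=> a b; apply: omorph_le.
have ftE (e : equalizer_poset u v) : f (t e) = val e.
  by apply: (omorphism_app e tE).
(* Both [t \o s] and the identity lift [f] along [f], so they are equal. *)
have [id' [_ f_uniq]] := f_univ _ _ uf_vf.
have tsK z : t (s z) = z.
  have id1 : id' = t \o monotone_map mon_s :> {omorphism _ -> _}.
    by apply: f_uniq; apply: omorphism_ext => w /=; rewrite ftE.
  have id2 : id' = idfun :> {omorphism _ -> _} by apply: f_uniq; apply: omorphism_ext.
  by move: (omorphism_app z id2); rewrite id1.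
by move=> le_fxy; rewrite -[x]tsK -[y]tsK; apply: omorph_le.
Qed.

(** The equalized pair consists of the lower set and the strict lower set,
    both cut down to the complement of the image of f: they differ at x only by
    whether x is outside this image. *)
Lemma embedding_regular_mono : embedding f -> @regular_mono (finPoset d) P Q f.
Proof.
case=> f_inj f_mono.
pose u (x : Q) : powerset_poset d Q := [set y | (y \notin codom f) && (y <= x)].
pose v (x : Q) : powerset_poset d Q := [set y | (y \notin codom f) && (y < x)].
have mon_u : {homo u : x y / x <= y}.
  move=> x y le_xy; apply/subsetP => z; rewrite !inE => /andP[-> /=].
  by move=> /le_trans; apply.
have mon_v : {homo v : x y / x <= y}.
  move=> x y le_xy; apply/subsetP => z; rewrite !inE => /andP[-> /=].
  by move=> /lt_le_trans; apply.
exists (powerset_poset d Q), (monotone_map mon_u), (monotone_map mon_v).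
have eq_uv x : u x = v x <-> x \in codom f.
  split=> [/setP/(_ x)|xf]; first by rewrite !inE lexx ltxx andbT andbF => /negbFE.
  apply/setP=> y; rewrite !inE lt_neqAle.
  by case: (eqVneq y x) => // ->; rewrite xf.
split=> [|Z h h_eq].
  by apply: omorphism_ext => x /=; apply/eq_uv/codom_f.
have hf z : h z \in codom f.
  by apply/eq_uv; apply: (omorphism_app z h_eq).
pose t z := iinv (hf z).
have ftE z : f (t z) = h z by apply: f_iinv.
have mon_t : {homo t : x y / x <= y}.
  by move=> x y le_xy; rewrite -f_mono !ftE; apply: omorph_le.
exists (monotone_map mon_t); split=> [|t' t'E]; first exact: omorphism_ext.
by apply: omorphism_ext => z; apply: f_inj; rewrite /= ftE -t'E.
Qed.

End RegularMono.

(** * Pushouts of embeddings *)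

(** The pushout is tested against the single cocone [z1], [z2] into the power
    set of X', where [z1] embeds X' by lower sets and [z2] is the least monotone
    extension of [z1 \o g] along f.  Since f reflects the order, [z2 \o f] is
    exactly [z1 \o g]. *)
Lemma pushout_embedding d (X X' Y P : finPOrderType d)
    (g : {omorphism X -> X'}) (f : {omorphism X -> Y})
    (p1 : {omorphism X' -> P}) (p2 : {omorphism Y -> P}) :
  @is_pullback (opposite (finPoset d)) X' Y X P g f p1 p2 ->
  embedding f -> embedding p1.
Proof.
case=> _ P_univ [_ f_mono].
pose z1 : X' -> powerset_poset d X' := @lower_set d X'.
pose z2 (y : Y) : powerset_poset d X' :=
  [set x' | [exists x, (f x <= y) && (x' <= g x)]].
have mon_z1 : {homo z1 : x y / x <= y} by move=> x y; rewrite -sub_lower_set.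
have mon_z2 : {homo z2 : x y / x <= y}.
  move=> x y le_xy; apply/subsetP => x'; rewrite !inE => /existsP[a /andP[le_ax le_xa]].
  by apply/existsP; exists a; rewrite le_xa (le_trans le_ax).
have z12 x : z1 (g x) = z2 (f x).
  apply/setP => x'; rewrite !inE; apply/idP/existsP => [le_x'|[a]].
    by exists x; rewrite lexx.
  by rewrite f_mono => /andP[/(omorph_le g) le_g /le_trans]; apply.
have [|t [[tE _] _]] := P_univ _ (monotone_map mon_z1) (monotone_map mon_z2).
  exact: omorphism_ext.
apply: mono_embedding => x y; apply/idP/idP => [|]; last exact: omorph_le.
have {}tE w : t (p1 w) = lower_set w.
  by apply: (omorphism_app w tE).
by move=> /(omorph_le t); rewrite !tE -[x <= y]sub_lower_set.
Qed.

Theorem proposition10p4 (d : Order.disp_t) :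
  coregular_category (finPoset d) /\
  (forall (P Q : finPOrderType d) (f : {omorphism P -> Q}),
     @regular_mono (finPoset d) P Q f <-> embedding f).
Proof.
have reg_emb (P Q : finPOrderType d) (f : {omorphism P -> Q}) :
    @regular_mono (finPoset d) P Q f <-> embedding f.
  by split; [apply: regular_mono_embedding|apply: embedding_regular_mono].
split=> //; split.
- by move=> J F [J_fin _]; apply: finite_colimit.
- move=> Y X P f p1 p2 _.
  by exists (equalizer_poset p1 p2), (equalizer_map p1 p2); apply: equalizer_mapP.
- move=> X' Y X P g f p1 p2 push /(reg_emb X Y) f_emb.
  exact/(reg_emb X' P)/(pushout_embedding push).
Qed.
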